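(* (Converse-like duality) Let $(\bar x, \bar\lambda^L, \bar\lambda^U, \bar\mu)\in \mathcal{F}_{MW}$. (i) If $\bar x\in\mathcal{F}$ and $(f, g_T)$ is $\mathcal{E}$-pseudo-quasi generalized convex on $\Omega$ at $\bar x$, then $\bar x$ is a type-2 $\mathcal{E}$-quasi-weakly Pareto solution of (SIVP). (ii) If $\bar x\in\mathcal{F}$ and $(f, g_T)$ is strictly $\mathcal{E}$-pseudo-quasi generalized convex on $\Omega$ at $\bar x$, then $\bar x$ is a type-1 $\mathcal{E}$-quasi Pareto solution of (SIVP).
   Context: **Generalized differentiation.** $\mathbb{R}^n$ carries the usual scalar product and Euclidean norm; $\mathbb{B}_{\mathbb{R}^n}$ is its closed unit ball; $\mathbb{R}^m_+$ is the nonnegative orthant. For $S\subset\mathbb{R}^n$, $x\in S$ and $\varepsilon\ge 0$, let $\widehat N_\varepsilon(x;S)=\{z^*\in\mathbb{R}^n : \limsup_{u\to x,\,u\in S}\frac{\langle z^*,u-x\rangle}{\|u-x\|}\le\varepsilon\}$. The Mordukhovich (limiting) normal cone of $S$ at $\bar x\in\mathrm{cl}\,S$ is $$N(\bar x;S)=\{z^*\in\mathbb{R}^n : \exists\, x^k\to\bar x \text{ with } x^k\in S,\ \varepsilon_k\to0^+,\ z_k^*\to z^*,\ z^*_k\in\widehat N_{\varepsilon_k}(x^k;S)\ \forall k\in\mathbb{N}\}.$$ The Mordukhovich (limiting) subdifferential of $\varphi:\mathbb{R}^n\to\mathbb{R}$ at $\bar x$ is $\partial\varphi(\bar x)=\{x^*\in\mathbb{R}^n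 : (x^*,-1)\in N((\bar x,\varphi(\bar x));\mathrm{epi}\,\varphi)\}$, where $\mathrm{epi}\,\varphi=\{(x,\alpha)\in\mathbb{R}^n\times\mathbb{R}:\alpha\ge\varphi(x)\}$. For a cone $K\subset\mathbb{R}^n$, $K^\circ=\{\nu\in\mathbb{R}^n : \langle z,\nu\rangle\le0\ \forall z\in K\}$ is its polar. **Intervals.** $\mathcal{K}_c$ is the set of closed bounded intervals $[a^L,a^U]$, $a^L\le a^U$, in $\mathbb{R}$. For $A=[a^L,a^U]$, $B=[b^L,b^U]$: $A-B=[a^L-b^U,a^U-b^L]$; $kA=[ka^L,ka^U]$ for $k\ge0$. $A\le_{LU}B$ means $a^L\le b^L$ and $a^U\le b^U$; $A<_{LU}B$ means $A\le_{LU}B$ and $A\ne B$; $A<^s_{LU}B$ means $a^L<b^L$ and $a^U<b^U$. **Problem.** $I=\{1,\ldots,m\}$. For $i\in I$, $f_i:\mathbb{R}^n\to\mathcal{K}_c$, $f_i(x)=[f_i^L(x),f_i^U(x)]$, where $f_i^L,f_i^U:\mathbb{R}^n\to\mathbb{R}$ are locally Lipschitz with $f_i^L\le f_i^U$ on $\mathbb{R}^n$. $T$ is an arbitrary (possibly infinite) index set, $g_t:\mathbb{R}^n\to\mathbb{R}$ ($t\in T$) are locally Lipschitz, $g_T=(g_t)_{t\in T}$, and $\Omega\subset\mathbb{R}^n$ is nonempty and closed. The primal problem (SIVP) is to minimize, in the lower-upper (LU) interval order sense, $f=(f_1,\ldots,f_m)$ over the feasible set $\mathcal{F}=\{x\in\Omega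 : g_t(x)\le0,\ t\in T\}$. Fix reals $0\le\epsilon_i^L\le\epsilon_i^U$ ($i\in I$), $\mathcal{E}_i=[\epsilon_i^L,\epsilon_i^U]$, $\mathcal{E}=(\mathcal{E}_1,\ldots,\mathcal{E}_m)$. $\mathbb{R}_+^{|T|}$ is the set of functions $\mu:T\to\mathbb{R}_+$, $\mu_t=\mu(t)$, that vanish at all but finitely many $t\in T$. **Primal solutions.** A point $\bar x\in\mathcal{F}$ is, for (SIVP): - a type-1 $\mathcal{E}$-quasi Pareto solution if there is no $x\in\mathcal{F}$ with $f_i(x)\le_{LU}f_i(\bar x)-\mathcal{E}_i\|x-\bar x\|$ for all $i\in I$ and $f_k(x)<_{LU}f_k(\bar x)-\mathcal{E}_k\|x-\bar x\|$ for at least one $k\in I$; - a type-2 $\mathcal{E}$-quasi-weakly Pareto solution if there is no $x\in\mathcal{F}$ with $f_i(x)<^s_{LU}f_i(\bar x)-\mathcal{E}_i\|x-\bar x\|$ for all $i\in I$. **Dual feasible set (Mond–Weir type).** $\mathcal{F}_{MW}$ is the set of all $(y,\lambda^L,\lambda^U,\mu)\in\Omega\times\mathbb{R}^m_+\times\mathbb{R}^m_+\times\mathbb{R}_+^{|T|}$ such that $$0\in\sum_{i\in I}[\lambda_i^L\partial f_i^L(y)+\lambda_i^U\partial f_i^U(y)]+\sum_{t\in T}\mu_t\partial g_t(y)+\sum_{i\in I}(\lambda_i^L\epsilon_i^U+\lambda_i^U\epsilon_i^L)\mathbb{B}_{\mathbb{R}^n}+N(y;\Omega),$$ $\mu_tg_t(y)\ge0$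 for all $t\in T$, and $\sum_{i\in I}(\lambda_i^L+\lambda_i^U)=1$. **Generalized convexity.** $(f,g_T)$ is $\mathcal{E}$-pseudo-quasi generalized convex on $\Omega$ at $\bar x\in\Omega$ if for any $x\in\Omega$, $z_i^{*L}\in\partial f_i^L(\bar x)$, $z_i^{*U}\in\partial f_i^U(\bar x)$ ($i\in I$), and $x_t^*\in\partial g_t(\bar x)$ ($t\in T$), there exists $\nu\in[N(\bar x;\Omega)]^\circ$ such that (a) $\langle z_i^{*L},\nu\rangle+\epsilon_i^U\|x-\bar x\|\ge0\Rightarrow f_i^L(x)\ge f_i^L(\bar x)-\epsilon_i^U\|x-\bar x\|$ for all $i\in I$; (b) $\langle z_i^{*U},\nu\rangle+\epsilon_i^L\|x-\bar x\|\ge0\Rightarrow f_i^U(x)\ge f_i^U(\bar x)-\epsilon_i^L\|x-\bar x\|$ for all $i\in I$; (c) $g_t(x)\le g_t(\bar x)\Rightarrow\langle x_t^*,\nu\rangle\le0$ for all $t\in T$; (d) $\langle b^*,\nu\rangle\le\|x-\bar x\|$ for all $b^*\in\mathbb{B}_{\mathbb{R}^n}$. It is strictly $\mathcal{E}$-pseudo-quasi generalized convex on $\Omega$ at $\bar x$ if the same holds for any $x\in\Omega\setminus\{\bar x\}$ (and any such $z_i^{*L},z_i^{*U},x_t^*$), with the concluding inequalities $\ge$ in (a) and (b) (those for $f_i^L(x)$ and $f_i^U(x)$) replaced by strict inequalities $>$. *)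

(* Defs.v *)
From HB Require Import structures.
From mathcomp Require Import all_boot all_order all_algebra.
From mathcomp Require Import all_classical all_reals all_analysis.

Set Implicit Arguments.
Unset Strict Implicit.
Unset Printing Implicit Defensive.

Import Order.TTheory GRing.Theory Num.Theory.
Import numFieldNormedType.Exports.

Local Open Scope classical_set_scope.
Local Open Scope ring_scope.

(* The library norm on ['rV[R]_n] is the sup norm, so the Euclidean one is
   defined here; the topology of ['rV[R]_n] is the same for both. *)
Section Euclidean.
Variables (R : realType) (n : nat).
Implicit Types (u v : 'rV[R]_n) (K S : set 'rV[R]_n).

Definition dotr u v : R := \sum_(j < n) u 0 j * v 0 j.

Definition enorm u : R := Num.sqrt (dotr u u).

Lemma enorm_ge0 u : 0 <= enorm u. Proof. exact: sqrtr_ge0. Qed.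

Definition unit_ball : set 'rV[R]_n := [set b | enorm b <= 1].

Definition polar K : set 'rV[R]_n :=
  [set nu | forall z, K z -> dotr z nu <= 0].

Definition locally_lipschitz (phi : 'rV[R]_n -> R) : Prop :=
  forall x : 'rV[R]_n, exists2 U, nbhs x U &
    exists L : R, forall u v, U u -> U v ->
      `|phi u - phi v| <= L * enorm (u - v).

(* The limsup is over [u] in [S], [u != x]; for an isolated point of [S] it is
   [-oo] and the condition is void. *)
Definition eps_normal (eps : R) (x : 'rV[R]_n) S : set 'rV[R]_n :=
  [set z | (limf_esup (fun u => (dotr z (u - x) / enorm (u - x))%:E)
              (within S x^') <= eps%:E)%E].

Definition limiting_normal_cone (xbar : 'rV[R]_n) S : set 'rV[R]_n :=
  [set z | exists (x : nat -> 'rV[R]_n) (eps : nat -> R)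
                  (zk : nat -> 'rV[R]_n),
    [/\ x k @[k --> \oo] --> xbar,
        forall k, S (x k),
        (forall k, 0 < eps k) /\ eps k @[k --> \oo] --> (0 : R),
        zk k @[k --> \oo] --> z &
        forall k, eps_normal (eps k) (x k) S (zk k)]].

Definition mink_add (A B : set 'rV[R]_n) : set 'rV[R]_n :=
  [set a + b | a in A & b in B].

Definition mink_scale (k : R) (A : set 'rV[R]_n) : set 'rV[R]_n :=
  [set k *: a | a in A].

Lemma mink_addA : associative mink_add.
Proof.
move=> A B C; apply/seteqP; split => x.
- move=> [a Aa [_ [b Bb [c Cc <-]] <-]].
  by exists (a + b); [exists a => //; exists b|exists c; rewrite ?addrA].
- move=> [_ [a Aa [b Bb <-]] [c Cc <-]].
  by exists a => //; exists (b + c); [exists b => //; exists c|rewrite addrA].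
Qed.

Lemma mink_addC : commutative mink_add.
Proof.
by move=> A B; apply/seteqP; split => x [a Aa [b Bb <-]];
  exists b => //; exists a => //; rewrite addrC.
Qed.

Lemma mink_add0 : left_id [set 0] mink_add.
Proof.
move=> A; apply/seteqP; split => x; first by move=> [_ -> [b Ab <-]]; rewrite add0r.
by move=> Ax; exists 0 => //; exists x; rewrite ?add0r.
Qed.

End Euclidean.

HB.instance Definition _ (R : realType) (n : nat) :=
  Monoid.isComLaw.Build (set 'rV[R]_n) [set 0] (@mink_add R n)
    (@mink_addA R n) (@mink_addC R n) (@mink_add0 R n).

Notation "A ⊕ B" := (mink_add A B)
  (at level 50, left associativity) : classical_set_scope.
Notation "k ⊙ A" := (mink_scale k A)
  (at level 40, left associativity) : classical_set_scope.

(* R^n x R is identified with R^(n+1), the real coordinate coming last. *)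
Section Subdifferential.
Variables (R : realType) (n : nat).
Implicit Types (phi : 'rV[R]_n -> R) (x : 'rV[R]_n).

Definition pair_rV x (a : R) : 'rV[R]_(n + 1) := row_mx x (const_mx a).

Definition epigraph phi : set 'rV[R]_(n + 1) :=
  [set pair_rV p.1 p.2 | p in [set p : 'rV[R]_n * R | phi p.1 <= p.2]].

Definition limiting_subdiff phi x : set 'rV[R]_n :=
  [set z | limiting_normal_cone (pair_rV x (phi x)) (epigraph phi)
             (pair_rV z (-1))].

End Subdifferential.

Section CompactIntervals.
Variable R : realType.

Record cintv : Type := CIntv { lo : R; hi : R; lo_le_hi : lo <= hi }.
Implicit Types A B : cintv.

Lemma cintv_sub_subproof A B : lo A - hi B <= hi A - lo B.
Proof. by apply: lerB; exact: lo_le_hi. Qed.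
Definition cintv_sub A B : cintv := CIntv (cintv_sub_subproof A B).

Lemma cintv_scale_subproof (k : R) (k0 : 0 <= k) A : k * lo A <= k * hi A.
Proof. by apply: ler_wpM2l => //; exact: lo_le_hi. Qed.
Definition cintv_scale (k : R) (k0 : 0 <= k) A : cintv :=
  CIntv (cintv_scale_subproof k0 A).

Definition LU_le A B : Prop := lo A <= lo B /\ hi A <= hi B.
Definition LU_lt A B : Prop := LU_le A B /\ A <> B.
Definition LU_slt A B : Prop := lo A < lo B /\ hi A < hi B.

End CompactIntervals.

Section SIVP.
Variables (R : realType) (n m : nat) (T : Type).
Variables (Omega : set 'rV[R]_n).
Variables (f : 'I_m -> 'rV[R]_n -> cintv R) (g : T -> 'rV[R]_n -> R).
Variable (E : 'I_m -> cintv R).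
Implicit Types (x y nu : 'rV[R]_n) (i : 'I_m) (t : T).

Definition fL i x : R := lo (f i x).
Definition fU i x : R := hi (f i x).
Definition epsL i : R := lo (E i).
Definition epsU i : R := hi (E i).

Definition feasible : set 'rV[R]_n :=
  [set x | Omega x /\ forall t, g t x <= 0].

Definition quasi_bound (xbar x : 'rV[R]_n) i : cintv R :=
  cintv_sub (f i xbar) (cintv_scale (enorm_ge0 (x - xbar)) (E i)).

Definition type1_quasi_Pareto (xbar : 'rV[R]_n) : Prop :=
  feasible xbar /\
  ~ exists x, [/\ feasible x,
      forall i, LU_le (f i x) (quasi_bound xbar x i) &
      exists k, LU_lt (f k x) (quasi_bound xbar x k)].

Definition type2_quasi_weakly_Pareto (xbar : 'rV[R]_n) : Prop :=
  feasible xbar /\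
  ~ exists x, feasible x /\
      forall i, LU_slt (f i x) (quasi_bound xbar x i).

Definition finsupp_nneg : set (T -> R) :=
  [set mu | (forall t, 0 <= mu t) /\ finite_set [set t | mu t != 0]].

(* The sum over [T] is the finite Minkowski sum over the support of [mu];
   [{classic T}] is [T] with a classical choice structure. *)
Definition MW_feasible y (lamL lamU : 'rV[R]_m) (mu : T -> R) : Prop :=
    [/\ Omega y,
        [/\ (forall i, 0 <= lamL 0 i), (forall i, 0 <= lamU 0 i) &
            finsupp_nneg mu],
        (\big[@mink_add R n/[set 0]]_(i < m)
            ((lamL 0 i ⊙ limiting_subdiff (fL i) y)
              ⊕ (lamU 0 i ⊙ limiting_subdiff (fU i) y))
          ⊕ \big[@mink_add R n/[set 0]]_(t \in [set t : {classic T} | mu t != 0])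
            (mu t ⊙ limiting_subdiff (g t) y)
          ⊕ \big[@mink_add R n/[set 0]]_(i < m)
            ((lamL 0 i * epsU i + lamU 0 i * epsL i) ⊙ @unit_ball R n)
          ⊕ limiting_normal_cone y Omega) 0,
        (forall t, 0 <= mu t * g t y) &
        \sum_(i < m) (lamL 0 i + lamU 0 i) = 1].

Definition pseudo_quasi_gconvex (xbar : 'rV[R]_n) : Prop :=
  forall x, Omega x ->
  forall (zL zU : 'I_m -> 'rV[R]_n) (xs : T -> 'rV[R]_n),
  (forall i, limiting_subdiff (fL i) xbar (zL i)) ->
  (forall i, limiting_subdiff (fU i) xbar (zU i)) ->
  (forall t, limiting_subdiff (g t) xbar (xs t)) ->
  exists2 nu, polar (limiting_normal_cone xbar Omega) nu &
    [/\ forall i, 0 <= dotr (zL i) nu + epsU i * enorm (x - xbar) ->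
          fL i x >= fL i xbar - epsU i * enorm (x - xbar),
        forall i, 0 <= dotr (zU i) nu + epsL i * enorm (x - xbar) ->
          fU i x >= fU i xbar - epsL i * enorm (x - xbar),
        forall t, g t x <= g t xbar -> dotr (xs t) nu <= 0 &
        forall b, @unit_ball R n b -> dotr b nu <= enorm (x - xbar)].

Definition strict_pseudo_quasi_gconvex (xbar : 'rV[R]_n) : Prop :=
  forall x, Omega x -> x <> xbar ->
  forall (zL zU : 'I_m -> 'rV[R]_n) (xs : T -> 'rV[R]_n),
  (forall i, limiting_subdiff (fL i) xbar (zL i)) ->
  (forall i, limiting_subdiff (fU i) xbar (zU i)) ->
  (forall t, limiting_subdiff (g t) xbar (xs t)) ->
  exists2 nu, polar (limiting_normal_cone xbar Omega) nu &
    [/\ forall i, 0 <= dotr (zL i) nu + epsU i * enorm (x - xbar) ->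
          fL i x > fL i xbar - epsU i * enorm (x - xbar),
        forall i, 0 <= dotr (zU i) nu + epsL i * enorm (x - xbar) ->
          fU i x > fU i xbar - epsL i * enorm (x - xbar),
        forall t, g t x <= g t xbar -> dotr (xs t) nu <= 0 &
        forall b, @unit_ball R n b -> dotr b nu <= enorm (x - xbar)].

End SIVP.

(* Main.v *)
Require Import Defs.
From mathcomp Require Import all_boot all_order all_algebra.
From mathcomp Require Import all_classical all_reals all_analysis.
From mathcomp Require Import ring lra.
Import Order.TTheory GRing.Theory Num.Theory.
Import numFieldNormedType.Exports.
Local Open Scope classical_set_scope.
Local Open Scope ring_scope.

(** Dual feasibility of [xbar] writes 0 as a combination of subgradients
[zL i], [zU i] of the objective bounds, subgradients [xs t] of the active
constraints, unit ball elements [b i] and a normal vector [w].  If a feasible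
[x] improved on [xbar], generalized convexity applied to exactly these
subgradients would give a direction [nu], polar to the normal cone, along which
each bracket [dotr (zL i) nu + epsU E i * d] and
[dotr (zU i) nu + epsL E i * d], with [d = enorm (x - xbar)], is negative: this
is the contrapositive of the implications on [fL] and [fU].  When the
combination is paired with [nu], the constraint terms and the normal vector
contribute at most 0 and the ball terms at most [d] times their coefficients,
so the brackets, weighted by [lamL] and [lamU], have a nonnegative sum.  The weights are nonnegative and sum to 1, so
the brackets cannot all be negative ([MW_some_nonneg]).  This settles both
parts at once; in the strict case [x = xbar] is excluded because [quasi_bound]
at [xbar] is [f xbar] itself, which is not strictly below itself.

One point is analytic.  Generalized convexity asks for a subgradient of every
[g t], whereas dual feasibility provides one only where [mu t] is nonzero, and
[T] may be infinite.  The others exist because a locally Lipschitz function has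
a nonempty limiting subdifferential at every point x
([limiting_subdiff_nonempty]).  The proof is variational: minimizing
[phi + k * |. - x|^2] over a small box yields a minimizer within O(1/k) of x,
at which [phi] has a proximal subgradient bounded by twice the Lipschitz
constant ([proximal_subgrad_approx]); proximal subgradients are Fréchet
normals to the epigraph ([proximal_eps_normal]), and by compactness they
accumulate at a limiting subgradient. *)

(** * Scalar product, Euclidean norm and topology *)

Section EuclideanFacts.
Context {R : realType} {n : nat}.
Implicit Types x u v w : 'rV[R]_n.

Lemma dotrDl u v w : dotr (u + v) w = dotr u w + dotr v w.
Proof. by rewrite -big_split; apply: eq_bigr => j _; rewrite mxE mulrDl. Qed.

Lemma dotrZl (a : R) u v : dotr (a *: u) v = a * dotr u v.
Proof. by rewrite mulr_sumr; apply: eq_bigr => j _; rewrite mxE mulrA. Qed.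

Lemma dotr0l v : dotr 0 v = 0.
Proof. by apply: big1 => j _; rewrite mxE mul0r. Qed.

Lemma dotr_suml (I : Type) (r : seq I) (F : I -> 'rV[R]_n) v :
  dotr (\sum_(i <- r) F i) v = \sum_(i <- r) dotr (F i) v.
Proof.
exact: (big_morph (fun u => dotr u v) (fun u w => dotrDl u w v) (dotr0l v)).
Qed.

Lemma dotrr_ge0 u : 0 <= dotr u u.
Proof. by apply: sumr_ge0 => j _; rewrite -expr2 sqr_ge0. Qed.

Lemma enorm_sqr u : enorm u ^+ 2 = dotr u u.
Proof. by rewrite sqr_sqrtr ?dotrr_ge0. Qed.

Lemma enorm0 : enorm (0 : 'rV[R]_n) = 0.
Proof. by rewrite /enorm dotr0l sqrtr0. Qed.

Lemma enorm_eq0 u : enorm u = 0 -> u = 0.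
Proof.
move=> u0; apply/rowP => j; rewrite mxE; apply/eqP; rewrite -sqrf_eq0.
have uu0 : dotr u u = 0 by rewrite -enorm_sqr u0 expr0n.
by apply/eqP; apply: (psumr_eq0P _ uu0) => // k _; rewrite -expr2 sqr_ge0.
Qed.

(** The topology is that of the sup norm, so this comparison is what turns
Euclidean estimates into convergence. *)
Lemma coord_le_enorm u j : `|u 0 j| <= enorm u.
Proof.
rewrite -(ler_pXn2r (_ : 0 < 2)%N) ?nnegrE ?enorm_ge0 // enorm_sqr real_normK ?num_real //.
rewrite /dotr (bigD1 j) //= -expr2 lerDl.
by apply: sumr_ge0 => k _; rewrite -expr2 sqr_ge0.
Qed.

Lemma enorm_lt_ball u v (e : R) : enorm (v - u) < e -> ball u e v.
Proof.
move=> uve; split; first exact: le_lt_trans (enorm_ge0 _) uve.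
move=> i j; rewrite (ord1 i) -ball_normE /= distrC.
by apply: le_lt_trans uve; rewrite -[X in `|X|](_ : (v - u) 0 j = _) ?coord_le_enorm // !mxE.
Qed.

Lemma dotr_self_continuous x : continuous (fun u => dotr (u - x) (u - x)).
Proof.
move=> u; rewrite /dotr /continuous_at.
have c j : (v - x) 0 j @[v --> u] --> (u - x) 0 j.
  have -> : (fun v => (v - x) 0 j) = (fun v => v 0 j - x 0 j).
    by apply/funext => v; rewrite !mxE.
  by rewrite !mxE; apply: (@cvgB _ _ _ (nbhs u)); [exact: coord_continuous|exact: cvg_cst].
apply: (@cvg_big R _ +%R 0 xpredT add_continuous _ (nbhs u) _
  (fun j (v : 'rV[R]_n) => (v - x) 0 j * (v - x) 0 j)) => j _.
by apply: cvgM; exact: c.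
Qed.

Lemma near_enorm_lt x {e : R} : 0 < e -> \forall v \near x, enorm (v - x) < e.
Proof.
move=> e_gt0.
have e2_gt0 : 0 < e ^+ 2 by rewrite exprn_gt0.
have /(_ x) c := dotr_self_continuous x.
have : \forall v \near x, dotr (v - x) (v - x) < e ^+ 2.
  by apply: (cvgr_lt _ c); rewrite subrr dotr0l.
apply: filterS => v; rewrite -enorm_sqr ltr_pXn2r // nnegrE ?enorm_ge0 //.
exact: ltW.
Qed.

End EuclideanFacts.

Lemma dotr_sub_expand {R : realType} {n : nat} (x u v : 'rV[R]_n) :
  dotr (v - x) (v - x) =
  dotr (u - x) (u - x) + 2 * dotr (u - x) (v - u) + dotr (v - u) (v - u).
Proof.
rewrite /dotr mulr_sumr -!big_split /=; apply: eq_bigr => j _.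
by rewrite !mxE; ring.
Qed.

Lemma dotr_pair_rV {R : realType} {n : nat} (u v : 'rV[R]_n) (a b : R) :
  dotr (pair_rV u a) (pair_rV v b) = dotr u v + a * b.
Proof.
rewrite /dotr big_split_ord big_ord1 /=; congr (_ + _).
  by apply: eq_bigr => j _; rewrite !row_mxEl.
by rewrite !row_mxEr !mxE.
Qed.

Lemma pair_rVB {R : realType} {n : nat} (u v : 'rV[R]_n) (a b : R) :
  pair_rV u a - pair_rV v b = pair_rV (u - v) (a - b).
Proof.
rewrite /pair_rV opp_row_mx add_row_mx; congr row_mx.
by apply/rowP => j; rewrite !mxE.
Qed.

(** Convergence in [R^(n + 1)] thus reduces to convergence of both components,
which is how sequences of points of, and normals to, an epigraph are handled. *)
Lemma ball_pair_rV {R : realType} {n : nat} (u v : 'rV[R]_n) (a b e : R) :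
  ball (pair_rV u a) e (pair_rV v b) <-> ball u e v /\ ball a e b.
Proof.
split=> [[e0 H]|[[e0 uv] ab]].
  split; first (split => // i j).
    by have := H i (lshift 1 j); rewrite !row_mxEl.
  by have := H 0 (rshift n 0); rewrite !row_mxEr !mxE.
split=> // i j; case: (splitP j) => k jk.
  by have -> : j = lshift 1 k by [exact: val_inj]; rewrite !row_mxEl.
by have -> : j = rshift n k by [exact: val_inj]; rewrite !row_mxEr !mxE.
Qed.

(** * Proximal subgradients *)

Definition proximal_subgrad {R : realType} {n : nat} (phi : 'rV[R]_n -> R)
    (u z : 'rV[R]_n) : Prop :=
  exists k : R, \forall v \near u,
    phi u + dotr z (v - u) <= phi v + k * dotr (v - u) (v - u).

(** The quadratic error is o(|v - u|), and moving up in the epigraph only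
decreases the pairing with [(z, -1)]; hence such a normal is of Fréchet type
and satisfies the estimate for every positive [eps]. *)
Lemma proximal_eps_normal {R : realType} {n : nat} {phi : 'rV[R]_n -> R}
    {u z : 'rV[R]_n} {eps : R} : 0 < eps -> proximal_subgrad phi u z ->
  eps_normal eps (pair_rV u (phi u)) (epigraph phi) (pair_rV z (-1)).
Proof.
move=> eps0 [k /nbhs_ballP[r /= r0 Hr]].
set p := pair_rV u (phi u).
(* On [V] the difference quotient is at most [`|k| * enorm (q - p)]. *)
pose V := [set q : 'rV[R]_(n + 1) | [/\ ball p r q, `|k| * enorm (q - p) < eps,
  q <> p & epigraph phi q]].
have VF : within (epigraph phi) p^' V.
  have d_gt0 : 0 < eps / (`|k| + 1) by rewrite divr_gt0 // ltr_pwDr.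
  apply: filterS2 (nbhsx_ballx p r r0) (near_enorm_lt p d_gt0).
  move=> q qb + /= /eqP qp qE; rewrite ltr_pdivlMr ?ltr_pwDr // => qe; split=> //.
  have := enorm_ge0 (q - p); lra.
apply: ge_ereal_inf; eexists; first by exists V; [exact: VF|reflexivity].
apply: ge_ereal_sup => _ [q [qb qe qp [[v a] /= va qE]] <-].
have N0 : 0 < enorm (q - p).
  by rewrite lt_def enorm_ge0 andbT; apply/eqP => /enorm_eq0/subr0_eq.
rewrite lee_fin ler_pdivrMr //; apply: le_trans (_ : `|k| * enorm (q - p) ^+ 2 <= _); last first.
  by rewrite expr2 mulrA ler_pM2r // ltW.
move: qb; rewrite enorm_sqr -qE => /ball_pair_rV[/Hr uv _].
rewrite /p !pair_rVB !dotr_pair_rV.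
have kD := ler_wpM2r (dotrr_ge0 (v - u)) (ler_norm k).
have ka : 0 <= `|k| * ((a - phi u) * (a - phi u)) by rewrite mulr_ge0 // -expr2 sqr_ge0.
by rewrite mulrDr; lra.
Qed.

(** Minimize [phi v + k * |v - x|^2] near [x].  Comparing the minimizer [u] with
[x] gives [k * |u - x|^2 <= L * |u - x|], so [u] is within [L / k] of [x] and
lies in the interior of the box for [k] large; expanding the square there shows
that [- 2 k (u - x)] is a proximal subgradient at [u].  Its size is at most
[2 L] whatever [k] is, which makes the compactness argument below possible. *)
Lemma proximal_subgrad_approx {R : realType} {n : nat} {phi : 'rV[R]_n -> R}
    (x : 'rV[R]_n) : locally_lipschitz phi ->
  exists C : R, forall e : R, 0 < e -> exists u z : 'rV[R]_n,
    [/\ ball x e u, ball (phi x) e (phi u), proximal_subgrad phi u z &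
        forall j, `|z 0 j| <= C].
Proof.
move=> /(_ x) [U /nbhs_ballP[r0 /= r0_gt0 ballU] [L0 lipU]].
pose L := `|L0| + 1.
have L_ge1 : 1 <= L by rewrite lerDr.
have lip u v : ball x r0 u -> ball x r0 v -> `|phi u - phi v| <= L * enorm (u - v).
  move=> /ballU Uu /ballU Uv; apply: le_trans (lipU _ _ Uu Uv) _.
  by apply: ler_wpM2r; [exact: enorm_ge0|rewrite (le_trans (ler_norm _)) // lerDl].
exists (2 * L) => e e_gt0.
pose r := r0 / 2.
have r_gt0 : 0 < r by rewrite divr_gt0.
have r_lt : r < r0 by rewrite /r; lra.
(* [d] is the bound [L / k] on [enorm (u - x)]; it is chosen so that [u] stays
   in the open box of radius [r] and both [u] and [phi u] are [e]-close. *)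
pose d := Num.min r e / (2 * L).
have min_gt0 : 0 < Num.min r e by rewrite lt_min r_gt0.
have d_gt0 : 0 < d by rewrite divr_gt0 //; lra.
have Ld : L * d < Num.min r e.
  have -> : L * d = Num.min r e / 2 by rewrite /d; field; lra.
  lra.
have [Ldr Lde] : L * d < r /\ L * d < e by move: Ld; rewrite lt_min => /andP.
have d_le : d <= L * d by rewrite ler_peMl // ltW.
(* The closed box of radius [r] is compact and, since [r < r0], still lies in
   the neighbourhood where [phi] is Lipschitz. *)
pose A := [set v : 'rV[R]_n | forall j, `[x 0 j - r, x 0 j + r]%classic (v 0 j)].
have A_compact : compact A.
  by apply: (@rV_compact _ _ (fun j => `[x 0 j - r, x 0 j + r]%classic)) => j; exact: segment_compact.
have ballA v : ball x r v -> A v.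
  move=> [_ xv] j; have := xv 0 j; rewrite -ball_normE /= in_itv /= ltr_distl => /andP[? ?].
  apply/andP; split; lra.
have A_ball v : A v -> ball x r0 v.
  move=> Av; split => // i j; rewrite (ord1 i) -ball_normE /= ltr_distl.
  by have := Av j; rewrite /= in_itv /= => /andP[? ?]; apply/andP; split; lra.
have Ax : A x by apply: ballA; exact: ballxx.
have [k k_gt0 kd] : exists2 k : R, 0 < k & k * d = L.
  exists (L / d); first by rewrite divr_gt0 //; lra.
  by rewrite divfK // gt_eqF.
pose psi v := phi v + k * dotr (v - x) (v - x).
have [|u /[!inE] Au u_min] := @compact_EVT_min _ _ psi A (ex_intro _ x Ax) A_compact.
  apply: continuous_in_subspaceT => v /[!inE] /A_ball xv.
  apply: (@cvgD _ _ _ (nbhs v)); last first.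
    by apply: (@cvgM _ _ (nbhs v)); [exact: cvg_cst|exact: dotr_self_continuous].
  apply/cvgrPdist_lt => eta eta_gt0.
  have xv_near : \forall w \near v, ball x r0 w.
    by apply: open_nbhs_nbhs; split => //; exact: ball_open.
  have L_gt0 : 0 < L by lra.
  have eL_gt0 : 0 < eta / L by rewrite divr_gt0.
  apply: filterS2 xv_near (near_enorm_lt v eL_gt0) => w xw wv.
  rewrite distrC; apply: le_lt_trans (lip _ _ xw xv) _.
  by rewrite mulrC -ltr_pdivlMr.
have xu : enorm (u - x) <= d.
  have := u_min x; rewrite inE => /(_ Ax).
  rewrite /psi subrr dotr0l mulr0 addr0 -enorm_sqr => psi_le.
  have phi_le : phi x - phi u <= L * enorm (u - x).
    apply: le_trans (ler_norm _) _; rewrite distrC.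
    by apply: lip; exact: A_ball.
  have : k * enorm (u - x) ^+ 2 <= L * enorm (u - x) by lra.
  have [->|N0] := eqVneq (enorm (u - x)) 0; first by move=> _; exact: ltW.
  have {}N0 : 0 < enorm (u - x) by rewrite lt_def N0 enorm_ge0.
  by rewrite expr2 mulrA ler_pM2r // -kd ler_pM2l.
have xu_lt : enorm (u - x) < r by lra.
exists u, (- (2 * k) *: (u - x)); split.
- by apply: enorm_lt_ball; lra.
- rewrite -ball_normE /= distrC; apply: le_lt_trans (lip _ _ _ _) _; [exact: A_ball|exact: A_ball|].
  by apply: le_lt_trans Lde; rewrite ler_pM2l //; lra.
- exists k; have near_u : \forall v \near u, ball x r v.
    apply: open_nbhs_nbhs; split; [exact: ball_open|exact: enorm_lt_ball].
  apply: filterS near_u => v /ballA Av; have := u_min v; rewrite inE => /(_ Av).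
  rewrite /psi (dotr_sub_expand _ u v) dotrZl => psi_le.
  lra.
- move=> j; rewrite mxE normrM normrN (@ger0_norm _ (2 * k)); last by lra.
  have := le_trans (coord_le_enorm (u - x) j) xu => xuj.
  by rewrite -kd mulrA ler_pM2l //; lra.
Qed.

Lemma cvg_ball_harmonic {R : realType} (V : pseudoMetricType R) (l : V) (s : nat -> V) :
  (forall k, ball l (harmonic k) (s k)) -> s k @[k --> \oo] --> l.
Proof.
move=> H; apply/cvg_ballP => e e0; near=> k.
apply: le_ball (H k); apply: ltW; near: k.
exact: (near_infty_natSinv_lt (PosNum e0)).
Unshelve. all: by end_near. Qed.

(** The proximal subgradients found arbitrarily close to [x] form a filter base
of subsets of one compact box; any cluster point is the limit of such
subgradients along base points tending to [x], that is, a limiting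
subgradient. *)
Lemma limiting_subdiff_nonempty {R : realType} {n : nat} {phi : 'rV[R]_n -> R}
    (x : 'rV[R]_n) : locally_lipschitz phi -> limiting_subdiff phi x !=set0.
Proof.
move=> /(proximal_subgrad_approx x)[C approx].
pose P (e : R) : set 'rV[R]_n := [set z | exists u, [/\ ball x e u,
  ball (phi x) e (phi u), proximal_subgrad phi u z & forall j, `|z 0 j| <= C]].
pose F := filter_from [set e : R | 0 < e] P.
have F_filter : ProperFilter F.
  apply: filter_from_proper; last first.
    by move=> e /approx[u [z [? ? ? ?]]]; exists z, u.
  apply: filter_from_filter; first by exists 1 => /=.
  move=> e1 e2 /= e1_gt0 e2_gt0; exists (Num.min e1 e2); first by rewrite /= lt_min e1_gt0.
  have [le1 le2] : Num.min e1 e2 <= e1 /\ Num.min e1 e2 <= e2.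
    by rewrite !ge_min !lexx orbT.
  move=> z [u [xu pu zu zC]]; split; exists u; split => //.
  - exact: le_ball xu.
  - exact: le_ball pu.
  - exact: le_ball xu.
  - exact: le_ball pu.
pose box := [set v : 'rV[R]_n | forall j, `[- C, C]%classic (v 0 j)].
have box_compact : compact box.
  by apply: (@rV_compact _ _ (fun=> `[- C, C]%classic)) => j; exact: segment_compact.
have [|z [_ z_cluster]] := box_compact F F_filter.
  exists 1 => //= z [u [_ _ _ zC]] j.
  by have := zC j; rewrite /= in_itv /= ler_norml.
have step (k : nat) : exists uz : 'rV[R]_n * 'rV[R]_n,
    [/\ ball x (harmonic k) uz.1, ball (phi x) (harmonic k) (phi uz.1),
        proximal_subgrad phi uz.1 uz.2 & ball z (harmonic k) uz.2].
  have FP : F (P (harmonic k)) by exists (harmonic k) => //=; exact: harmonic_gt0.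
  have [zk [[u [? ? ? _]] ?]] := z_cluster _ _ FP (nbhsx_ballx z (harmonic k) (harmonic_gt0 k)).
  by exists (u, zk).
have [uz uzP] := choice step.
exists z; exists (fun k => pair_rV (uz k).1 (phi (uz k).1)), harmonic,
  (fun k => pair_rV (uz k).2 (-1)); split.
- by apply: cvg_ball_harmonic => k; apply/ball_pair_rV; have [] := uzP k.
- by move=> k; exists ((uz k).1, phi (uz k).1) => /=.
- by split; [exact: harmonic_gt0|exact: cvg_harmonic].
- apply: cvg_ball_harmonic => k; apply/ball_pair_rV; have [_ _ _ ?] := uzP k; split=> //.
  by apply: ballxx; exact: harmonic_gt0.
- by move=> k; apply: proximal_eps_normal; [exact: harmonic_gt0|have [] := uzP k].
Qed.

(** * Multipliers extracted from dual feasibility *)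

(** Summands are recorded as a function of the index, which is possible only
when no index is repeated. *)
Lemma mink_bigP {R : realType} {n : nat} {I : eqType} {r : seq I}
    {A : I -> set 'rV[R]_n} {v : 'rV[R]_n} :
  uniq r -> (\big[@mink_add R n/[set 0]]_(i <- r) A i) v ->
  exists2 a : I -> 'rV[R]_n, (forall i, i \in r -> A i (a i)) & v = \sum_(i <- r) a i.
Proof.
elim: r v => [|i r IH] v /=.
  by rewrite big_nil => _ ->; exists (fun=> 0) => //; rewrite big_nil.
rewrite big_cons => /andP[ir r_uniq] [b Ab [_ /(IH _ r_uniq)[a aA ->] <-]].
exists (fun j => if j == i then b else a j) => [j|].
  by rewrite inE; case: eqVneq => [-> _|_ /aA].
rewrite big_cons eqxx; congr (_ + _); apply: eq_big_seq => j jr.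
by case: eqVneq ir => // <-; rewrite jr.
Qed.

Lemma mink_ordP {R : realType} {n m : nat} {A : 'I_m -> set 'rV[R]_n} {v : 'rV[R]_n} :
  (\big[@mink_add R n/[set 0]]_(i < m) A i) v ->
  exists2 a : 'I_m -> 'rV[R]_n, (forall i, A i (a i)) & v = \sum_(i < m) a i.
Proof.
move=> /(mink_bigP (index_enum_uniq _))[a aA ->].
by exists a => // i; apply: aA; rewrite mem_index_enum.
Qed.

(** The subgradients of the objective bounds always come from the inclusion,
even for zero weights, because [0 ⊙ A] is empty when [A] is; only those of the
constraints outside the support of [mu] have to be supplied by
[limiting_subdiff_nonempty]. *)
Lemma MW_stationary {R : realType} {n m : nat} {T : Type} {Omega : set 'rV[R]_n}
    {f : 'I_m -> 'rV[R]_n -> cintv R} {g : T -> 'rV[R]_n -> R} {E : 'I_m -> cintv R}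
    {y : 'rV[R]_n} {lamL lamU : 'rV[R]_m} {mu : T -> R} :
  (forall t, locally_lipschitz (g t)) ->
  MW_feasible Omega f g E y lamL lamU mu ->
  exists (zL zU : 'I_m -> 'rV[R]_n) (xs : T -> 'rV[R]_n),
    [/\ forall i, limiting_subdiff (fL f i) y (zL i),
        forall i, limiting_subdiff (fU f i) y (zU i),
        forall t, limiting_subdiff (g t) y (xs t) &
        exists (r : seq T) (b : 'I_m -> 'rV[R]_n) (w : 'rV[R]_n),
        [/\ forall i, @unit_ball R n (b i), limiting_normal_cone y Omega w &
         \sum_(i < m) (lamL 0 i *: zL i + lamU 0 i *: zU i)
           + \sum_(t <- r) mu t *: xs t
           + \sum_(i < m) (lamL 0 i * epsU E i + lamU 0 i * epsL E i) *: b i + w = 0]].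
Proof.
move=> g_lip [_ [_ _ [_ mu_fin]] + _ _].
rewrite (@fsbig_finite _ _ _ {classic T}) //.
set r := finmap.enum_fset _.
move=> [_ [_ [_ /mink_ordP[a aP ->] [_ /mink_bigP -/(_ (finmap.fset_uniq _))[c cP ->] <-]]
  [_ /mink_ordP[b' b'P ->] <-]] [w wN sum0]].
have /choice[z zP] i : exists z : 'rV[R]_n * 'rV[R]_n,
    [/\ limiting_subdiff (fL f i) y z.1, limiting_subdiff (fU f i) y z.2 &
        a i = lamL 0 i *: z.1 + lamU 0 i *: z.2].
  by have [_ [zL zLP <-] [_ [zU zUP <-] <-]] := aP i; exists (zL, zU).
have /choice[xs xsP] (t : {classic T}) : exists x : 'rV[R]_n,
    limiting_subdiff (g t) y x /\ (t \in r -> c t = mu t *: x).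
  have [/cP[x xP <-]|_] := boolP (t \in r); first by exists x.
  by have [x xP] := limiting_subdiff_nonempty y (g_lip t); exists x.
have /choice[b bP] i : exists b : 'rV[R]_n,
    @unit_ball R n b /\ b' i = (lamL 0 i * epsU E i + lamU 0 i * epsL E i) *: b.
  by have [b bP <-] := b'P i; exists b.
exists (fun i => (z i).1), (fun i => (z i).2), xs; split.
- by move=> i; have [] := zP i.
- by move=> i; have [] := zP i.
- by move=> t; have [] := xsP t.
exists r, b, w; split=> //; first by move=> i; have [] := bP i.
rewrite -[RHS]sum0; congr (_ + _ + _ + _).
- by apply: eq_bigr => i _; have [] := zP i.
- by apply: (@eq_big_seq _ _ _ {classic T} r) => t tr; have [_ ->] := xsP t.
- by apply: eq_bigr => i _; have [_ ->] := bP i.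
Qed.

(** The form in which dual feasibility is used: its subgradients do not all
point to descent beyond the tolerance.  The hypothesis on [xs t] is only
required where [0 <= g t y], as [mu t * g t y >= 0] forces this sign when
[mu t] is positive. *)
Lemma MW_some_nonneg {R : realType} {n m : nat} {T : Type} {Omega : set 'rV[R]_n}
    {f : 'I_m -> 'rV[R]_n -> cintv R} {g : T -> 'rV[R]_n -> R} {E : 'I_m -> cintv R}
    {y : 'rV[R]_n} {lamL lamU : 'rV[R]_m} {mu : T -> R} :
  (forall t, locally_lipschitz (g t)) -> (forall i, 0 <= epsL E i) ->
  MW_feasible Omega f g E y lamL lamU mu ->
  exists (zL zU : 'I_m -> 'rV[R]_n) (xs : T -> 'rV[R]_n),
    [/\ forall i, limiting_subdiff (fL f i) y (zL i),
        forall i, limiting_subdiff (fU f i) y (zU i),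
        forall t, limiting_subdiff (g t) y (xs t) &
        forall (nu : 'rV[R]_n) (d : R),
          polar (limiting_normal_cone y Omega) nu ->
          (forall t, 0 <= g t y -> dotr (xs t) nu <= 0) ->
          (forall b, @unit_ball R n b -> dotr b nu <= d) ->
          exists i, 0 <= dotr (zL i) nu + epsU E i * d \/
                    0 <= dotr (zU i) nu + epsL E i * d].
Proof.
move=> g_lip E_ge0 MW.
have [zL [zU [xs [zLP zUP xsP [r [b [w [bP wP sum0]]]]]]]] := MW_stationary g_lip MW.
have [_ [lamL_ge0 lamU_ge0 [mu_ge0 _]] _ mug_ge0 lam_sum] := MW.
exists zL, zU, xs; split=> // nu d nu_polar xs_nu ball_nu.
apply: contrapT => no_i.
have neg i : dotr (zL i) nu + epsU E i * d < 0 /\ dotr (zU i) nu + epsL E i * d < 0.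
  by split; rewrite ltNge; apply/negP => ?; apply: no_i; exists i; [left|right].
pose term i := lamL 0 i * (dotr (zL i) nu + epsU E i * d)
  + lamU 0 i * (dotr (zU i) nu + epsL E i * d).
have term_le0 i : term i <= 0.
  by have [negL negU] := neg i; rewrite -oppr_ge0 opprD -!mulrN addr_ge0 // mulr_ge0 // oppr_ge0 ltW.
have sum_ge0 : 0 <= \sum_(i < m) term i.
  have g_le0 : \sum_(t <- r) dotr (mu t *: xs t) nu <= 0.
    apply: sumr_le0 => t _; rewrite dotrZl.
    have [->|mu_neq0] := eqVneq (mu t) 0; first by rewrite mul0r.
    have mu_gt0 : 0 < mu t by rewrite lt_def mu_neq0 mu_ge0.
    by rewrite pmulr_rle0 //; apply: xs_nu; rewrite -(pmulr_rge0 _ mu_gt0).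
  have w_le0 : dotr w nu <= 0 by exact: nu_polar.
  have : \sum_(i < m) (dotr (lamL 0 i *: zL i + lamU 0 i *: zU i) nu
      + dotr ((lamL 0 i * epsU E i + lamU 0 i * epsL E i) *: b i) nu) <= \sum_(i < m) term i.
    apply: ler_sum => i _; rewrite dotrDl !dotrZl.
    have epsU_ge0 : 0 <= epsU E i by exact: le_trans (E_ge0 i) (lo_le_hi _).
    have coef_ge0 : 0 <= lamL 0 i * epsU E i + lamU 0 i * epsL E i.
      by rewrite addr_ge0 // mulr_ge0.
    have := ler_wpM2l coef_ge0 (ball_nu _ (bP i)).
    rewrite /term; lra.
  have := congr1 (fun v => dotr v nu) sum0.
  rewrite !dotrDl !dotr_suml dotr0l big_split /=; lra.
have term0 i : term i = 0.
  have sum0' : \sum_(j < m) - term j = 0.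
    by rewrite sumrN; apply/eqP; rewrite oppr_eq0 eq_le sum_ge0 sumr_le0.
  apply/eqP; rewrite -oppr_eq0; apply/eqP; apply: (psumr_eq0P _ sum0') => // j _.
  by rewrite oppr_ge0.
(* The bracket factors being negative, a vanishing term has zero weights. *)
have lam0 i : lamL 0 i + lamU 0 i = 0.
  have [negL negU] := neg i; have := term0 i; rewrite /term => ti.
  have pL := mulr_ge0_le0 (lamL_ge0 i) (ltW negL).
  have pU := mulr_ge0_le0 (lamU_ge0 i) (ltW negU).
  have : 0 <= lamL 0 i * (dotr (zL i) nu + epsU E i * d) by lra.
  have : 0 <= lamU 0 i * (dotr (zU i) nu + epsL E i * d) by lra.
  rewrite (nmulr_lge0 _ negL) (nmulr_lge0 _ negU).
  have := lamL_ge0 i; have := lamU_ge0 i; lra.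
by move: lam_sum; rewrite big1 // => /esym/eqP; rewrite oner_eq0.
Qed.

(** * Intervals and the duality theorem *)

Lemma cintv_eq {R : realType} (A B : cintv R) : lo A = lo B -> hi A = hi B -> A = B.
Proof.
case: A B => [a a' aa'] [b b' bb'] /= lo_eq hi_eq; subst.
by congr CIntv; exact: bool_irrelevance.
Qed.

Lemma quasi_bound_refl {R : realType} {n m : nat} (f : 'I_m -> 'rV[R]_n -> cintv R)
  (E : 'I_m -> cintv R) (x : 'rV[R]_n) i : quasi_bound f E x x i = f i x.
Proof. by apply: cintv_eq; rewrite /= subrr enorm0 mul0r subr0. Qed.

Theorem theorem4p4 (R : realType) (n m : nat) (T : Type)
  (Omega : set 'rV[R]_n)
  (f : 'I_m -> 'rV[R]_n -> cintv R) (g : T -> 'rV[R]_n -> R)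
  (E : 'I_m -> cintv R)
  (Omega_neq0 : Omega !=set0) (Omega_closed : closed Omega)
  (fL_lip : forall i, locally_lipschitz (fL f i))
  (fU_lip : forall i, locally_lipschitz (fU f i))
  (g_lip : forall t, locally_lipschitz (g t))
  (E_ge0 : forall i, 0 <= epsL E i)
  (xbar : 'rV[R]_n) (lamL lamU : 'rV[R]_m) (mu : T -> R)
  (dual_feas : MW_feasible Omega f g E xbar lamL lamU mu) :
  (feasible Omega g xbar -> pseudo_quasi_gconvex Omega f g E xbar ->
     type2_quasi_weakly_Pareto Omega f g E xbar) /\
  (feasible Omega g xbar -> strict_pseudo_quasi_gconvex Omega f g E xbar ->
     type1_quasi_Pareto Omega f g E xbar).
Proof.
have [zL [zU [xs [zLP zUP xsP some_nonneg]]]] :=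
  MW_some_nonneg g_lip E_ge0 dual_feas.
split=> xbar_feas gconv; split=> //.
- move=> [x [[x_Omega x_feas] x_better]].
  have [nu nu_polar [convL convU conv_g nu_ball]] := gconv x x_Omega zL zU xs zLP zUP xsP.
  have [|i] := some_nonneg nu _ nu_polar _ nu_ball.
    by move=> t g_ge0; apply: conv_g; exact: le_trans (x_feas t) g_ge0.
  have [/= ltL ltU] := x_better i.
  by case=> [/convL|/convU]; rewrite leNgt mulrC => /negP; apply.
- move=> [x [[x_Omega x_feas] x_better [k x_better_k]]].
  have x_neq : x <> xbar.
    by move=> xE; case: x_better_k => _; rewrite xE quasi_bound_refl.
  have [nu nu_polar [convL convU conv_g nu_ball]] := gconv x x_Omega x_neq zL zU xs zLP zUP xsP.
  have [|i] := some_nonneg nu _ nu_polar _ nu_ball.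
    by move=> t g_ge0; apply: conv_g; exact: le_trans (x_feas t) g_ge0.
  have [/= leL leU] := x_better i.
  by case=> [/convL|/convU]; rewrite ltNge mulrC => /negP; apply.
Qed.
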